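(* Let $W$ be a nonnegative random variable with finite and nonzero mean $\mu=\mathbb{E}[W]$, and assume that the moment generating function of $W$ exists everywhere, i.e. $\mathbb{E}[e^{\theta W}]<\infty$ for all $\theta\in\mathbb{R}$. If there exists a size biased coupling $W^s$ of $W$ (that is, a random variable $W^s$ defined on a common probability space with $W$ and having the $W$ size biased distribution) satisfying $|W^s-W|\le K$ almost surely for some $K>0$, then for any $t\ge 0$, $$\mathbb{P}(W-\mu\le -t)\le\exp\left(-\frac{t^2}{4K\mu}\right)\quad\text{and}\quad\mathbb{P}(W-\mu\ge t)\le\exp\left(-\frac{t^2}{4K\mu+Kt}\right).$$
   Context: For a nonnegative random variable $W$ with mean $\mu=\mathbb{E}[W]\in(0,\infty)$, a random variable $W^s$ has the $W$ size biased distribution if $\mathbb{E}[Wf(W)]=\mu\,\mathbb{E}[f(W^s)]$ for all functions $f$ for which these expectations exist; equivalently, if $W$ has distribution $dF(x)$, then $W^s$ has distribution $x\,dF(x)/\mu$. *)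

(* Defs.v *)
From HB Require Import structures.
From mathcomp Require Import all_boot all_order all_algebra.
From mathcomp Require Import all_classical all_reals all_analysis.
Set Implicit Arguments.
Unset Strict Implicit.
Unset Printing Implicit Defensive.

Import Order.TTheory GRing.Theory Num.Theory.
Import numFieldNormedType.Exports.

Local Open Scope classical_set_scope.
Local Open Scope ring_scope.
Local Open Scope ereal_scope.

(* Since ['E_P] is total, "whenever the expectations exist" is spelled out as
   integrability of both [W * f W] and [f Ws], for f a Borel function.
   Taking f to be an indicator shows that, when [W] has a finite nonzero mean,
   this determines the law of [Ws]. *)
Definition size_biased (d : measure_display) (T : measurableType d)
    (R : realType) (P : probability T R) (W Ws : {RV P >-> R}) : Prop :=
  forall f : R -> R, measurable_fun [set: R] f ->
    P.-integrable [set: T] (fun w => (W w * f (W w))%:E) ->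
    P.-integrable [set: T] (fun w => (f (Ws w))%:E) ->
    'E_P[fun w => (W w * f (W w))%R] = 'E_P[W] * 'E_P[f \o Ws].

(* Main.v *)
(** Write [m x] for the moment generating function of [W]. Size biasing gives
    [m' x = E (W * expR (x * W)) = mu * E (expR (x * Ws))], and the coupling
    compares the right-hand side with [mu * expR (K * x) * m x], from above for
    [0 <= x] and from below for [x <= 0]. Integrating from [0],
    [ln (m x) <= mu / K * (expR (K * x) - 1)] for every [x], and both tails
    follow from Chernoff's bound. Differentiation under the integral is avoided:
    Jensen's inequality bounds the increments of [ln m] along the segment from
    [0] to [x], with an error that vanishes when the segment is subdivided. *)

Require Import Defs.
From HB Require Import structures.
From mathcomp Require Import all_boot all_order all_algebra.
From mathcomp Require Import all_classical all_reals all_analysis.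
From mathcomp Require Import measurable_realfun ring lra.

Set Implicit Arguments.
Unset Strict Implicit.
Unset Printing Implicit Defensive.

Import Order.TTheory GRing.Theory Num.Theory.
Import numFieldNormedType.Exports.

Local Open Scope classical_set_scope.
Local Open Scope ring_scope.

(** * Elementary inequalities for the exponential and a subdivision argument *)

(** By convexity, the graph of [expR (c * x)] lies above its tangent at [y]. *)
Lemma mul_expRB1_le (R : realType) (c x y : R) :
  (x - y) * expR (c * y) * c <= expR (c * x) - expR (c * y).
Proof.
have -> : c * x = c * y + c * (x - y) by ring.
rewrite expRD.
have := expR_ge1Dx (c * (x - y)); have := expR_gt0 (c * y).
nra.
Qed.

(** Since [expR (- u) >= 1 - u], [expR u] is at most [1 / (1 - u)], and [(1 - u) * (1 + u + u ^+ 2)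
    = 1 - u ^+ 3 >= 1]. *)
Lemma expR_le_quad (R : realType) (u : R) :
  u <= 0 -> expR u <= 1 + u + u ^+ 2.
Proof.
move=> u0; have := expR_ge1Dx (- u); have := expR_gt0 u.
have := expRxMexpNx_1 u; move: (expR u) (expR (- u)) => a b ab a0 b1.
have : a * (1 - u) <= 1 by nra.
nra.
Qed.

(** With [u = 2 * v] this is [expR u - 1 - u <= u ^+ 2 / (1 - u / 2)], cleared of its denominator.
    Bounding [expR (- u)] below by [(1 - v / 2) ^+ 4] leaves a polynomial inequality. *)
Lemma expR_le_pade (R : realType) (v : R) : 0 <= v < 1 ->
  expR (2 * v) * (1 - v) <= 1 + v + 2 * v ^+ 2.
Proof.
move=> /andP[v0 v1].
have h : (1 - v / 2) ^+ 4 <= expR (- (2 * v)).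
  have -> : - (2 * v) = 4 * (- (v / 2)) by lra.
  rewrite expRM_natl lerXn2r ?nnegrE ?expR_ge0//; first by lra.
  exact: expR_ge1Dx.
have p : 1 - v <= (1 + v + 2 * v ^+ 2) * (1 - v / 2) ^+ 4.
  rewrite -subr_ge0.
  have -> : (1 + v + 2 * v ^+ 2) * (1 - v / 2) ^+ 4 - (1 - v)
    = v ^+ 2 * (3/2 * (1 - v) ^+ 2
        + v ^+ 2 * (17/16 - 15/16 * v + v ^+ 2 / 8)) by field.
  by rewrite mulr_ge0 ?sqr_ge0// addr_ge0 ?mulr_ge0 ?sqr_ge0//; nra.
have s0 : 0 < 1 + v + 2 * v ^+ 2 by nra.
have := expRxMexpNx_1 (2 * v); have := expR_gt0 (2 * v).
move: h p s0; move: (expR (2 * v)) (expR _) (_ ^+ 4) (1 + v + _) => a b q s.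
move=> qb vs s0 a0 ab.
have : 1 - v <= s * b by nra.
nra.
Qed.

(* Summing over a subdivision of [0, 1] into [n] equal parts, the right-hand
   side telescopes to [(k 1 - k 0) / n]. *)
Lemma le_of_increment_le (R : realType) (f k : R -> R) :
  (forall s r, 0 <= s -> s <= r -> r <= 1 ->
     f r - f s <= (r - s) * (k r - k s)) -> f 1 <= f 0.
Proof.
move=> fk.
have step (n : nat) : f 1 - f 0 <= n.+1%:R^-1 * (k 1 - k 0).
  have n0 : n.+1%:R != 0 :> R by rewrite pnatr_eq0.
  pose p (i : nat) : R := i%:R / n.+1%:R.
  have p0 : p 0%N = 0 by rewrite /p mul0r.
  have p1 : p n.+1 = 1 by rewrite /p divff.
  have := telescope_sumr (f \o p) (leq0n n.+1).
  have := telescope_sumr (k \o p) (leq0n n.+1).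
  rewrite /= p0 p1 => <- <-; rewrite mulr_sumr.
  rewrite big_nat [leRHS]big_nat; apply: ler_sum => i /andP[_ ilt].
  have <- : p i.+1 - p i = n.+1%:R^-1.
    by rewrite /p -mulrBl -natrB// subSnn mul1r.
  apply: fk.
  - by rewrite /p divr_ge0.
  - by rewrite /p ler_pM2r ?invr_gt0 ?ltr0n// ler_nat.
  - by rewrite /p ler_pdivrMr ?ltr0n// mul1r ler_nat.
rewrite -subr_le0 -[leRHS](mul0r (k 1 - k 0)).
have lim0 : (n.+1%:R^-1 * (k 1 - k 0)) @[n --> \oo] --> 0 * (k 1 - k 0).
  by apply: cvgMr_tmp; exact: cvg_harmonic.
by apply: (cvgr_to_ge lim0); exact: nearW step.
Qed.

(** * Integrability and tilting of the moment generating function *)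

Lemma measurable_expRM d (T : measurableType d) (R : realType)
    (P : probability T R) (W : {RV P >-> R}) (x : R) :
  measurable_fun setT (fun w => expR (W w * x)).
Proof.
apply: (measurableT_comp (@measurable_expR R)).
exact: measurable_funM.
Qed.

Lemma integrable_mgf d (T : measurableType d) (R : realType)
    (P : probability T R) (W : {RV P >-> R}) (x : R) :
  ('M_P W x < +oo)%E -> P.-integrable setT (fun w => (expR (W w * x))%:E).
Proof.
move=> Wx; have mE := measurable_expRM W x.
apply/integrableP; split; first exact/measurable_EFinP.
move: Wx; rewrite /mmt_gen_fun unlock; apply: le_lt_trans.
by under eq_integral do rewrite /= ger0_norm ?expR_ge0//.
Qed.

(** Domination: [|w| <= expR w + expR (- w)], so the exponents [x + 1] and [x - 1] suffice. *)
Lemma integrable_mul_mgf d (T : measurableType d) (R : realType)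
    (P : probability T R) (W : {RV P >-> R}) (x : R) :
  (forall y : R, 'M_P W y < +oo)%E ->
  P.-integrable setT (fun w => (W w * expR (W w * x))%:E).
Proof.
move=> Wfin.
apply: (le_integrable measurableT _ _ (integrableD measurableT
  (integrable_mgf (Wfin (x + 1))) (integrable_mgf (Wfin (x - 1))))).
  apply/measurable_EFinP; apply: measurable_funM => //.
  exact: measurable_expRM.
move=> w _ /=; rewrite lee_fin normrM (ger0_norm (expR_ge0 _)).
rewrite (ger0_norm (addr_ge0 (expR_ge0 _) (expR_ge0 _))).
rewrite mulrDr mulrBr mulr1 !expRD -mulrDr mulrC ler_pM2l ?expR_gt0//.
have := expR_ge1Dx (W w); have := expR_ge1Dx (- W w).
have := expR_gt0 (W w); have := expR_gt0 (- W w).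
by case: (ger0P (W w)) => ?; lra.
Qed.

(* Jensen's inequality for the law of [W] tilted by [expR (x * W)], whose mean
   lies on the appropriate side of [c]. *)
Lemma mgf_tilt_le d (T : measurableType d) (R : realType)
    (P : probability T R) (W : {RV P >-> R}) (x y c : R) :
  (forall z : R, 'M_P W z < +oo)%E ->
  (x - y) * \int[P]_w (W w * expR (W w * x))
    <= (x - y) * (c * \int[P]_w (expR (W w * x))) ->
  \int[P]_w (expR (W w * x))
    <= expR ((x - y) * c) * \int[P]_w (expR (W w * y)).
Proof.
move=> Wfin.
have ix := integrable_mgf (Wfin x); have iy := integrable_mgf (Wfin y).
have iWx := integrable_mul_mgf x Wfin.
move=> h.
(* The middle integrand is [expR (W w * x) * (1 + u)] with [u = (x - y) * (c - W w)]. By [h] its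
   integral is at least that of [expR (W w * x)]; pointwise, [1 + u <= expR u]. *)
apply: (@le_trans _ _ (\int[P]_w ((1 + (x - y) * c) * expR (W w * x)
  - (x - y) * (W w * expR (W w * x))))).
  rewrite RintegralB//; [|exact: (integrableZl measurableT _ ix)
                         |exact: (integrableZl measurableT _ iWx)].
  by rewrite !RintegralZl//; lra.
rewrite -RintegralZl//; apply: le_Rintegral => //.
- rewrite [X in P.-integrable _ X](_ : _ =
      (fun w => (1 + (x - y) * c)%:E * (expR (W w * x))%:E
        - (x - y)%:E * (W w * expR (W w * x))%:E)%E)//.
  apply: integrableB => //; exact: integrableZl.
- exact: (integrableZl measurableT _ iy).
- move=> w _; rewrite -expRD.
  have -> : (x - y) * c + W w * y = W w * x + (x - y) * (c - W w) by ring.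
  rewrite expRD; have := expR_ge1Dx ((x - y) * (c - W w)).
  have := expR_gt0 (W w * x); nra.
Qed.

(** * Consequences of the bounded size biased coupling *)

Lemma ge0_ae_le_Rintegral d (T : measurableType d) (R : realType)
    (P : {measure set T -> \bar R}) (f g : T -> R) :
  P.-integrable setT (EFin \o f) -> P.-integrable setT (EFin \o g) ->
  (forall w, 0 <= f w) -> (forall w, 0 <= g w) ->
  {ae P, forall w, f w <= g w} -> \int[P]_w f w <= \int[P]_w g w.
Proof.
move=> fi gi f0 g0 fg; apply: fine_le; try exact: integrable_fin_num.
apply: ae_ge0_le_integral => //.
- by move=> w _; rewrite lee_fin.
- exact: (measurable_int P).
- by move=> w _; rewrite lee_fin.
- exact: (measurable_int P).
- by apply: filterS fg => w fg _; rewrite lee_fin.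
Qed.

Lemma ae_expR_coupling d (T : measurableType d) (R : realType)
    (P : probability T R) (W V : T -> R) (K x : R) :
  {ae P, forall w, `|V w - W w| <= K} ->
  {ae P, forall w, expR (V w * x) <= expR (K * `|x|) * expR (W w * x)}.
Proof.
apply: filterS => w VW; rewrite -expRD ler_expR -lerBlDr -mulrBl.
by rewrite (le_trans (ler_norm _))// normrM ler_wpM2r.
Qed.

(** Provides the integrability that [size_biased] demands of the test function [expR (y * x)] at
    [V]. *)
Lemma mgf_coupling_lty d (T : measurableType d) (R : realType)
    (P : probability T R) (W V : {RV P >-> R}) (K : R) :
  (forall y : R, 'M_P W y < +oo)%E ->
  {ae P, forall w, `|V w - W w| <= K} ->
  forall x : R, ('M_P V x < +oo)%E.
Proof.
move=> Wfin VW x.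
have : ('E_P[fun w => (expR (K * `|x|) * expR (W w * x))%R] < +oo)%E.
  rewrite unlock ltey_eq; apply/orP; left.
  apply: integrable_fin_num => //.
  exact: (integrableZl measurableT _ (integrable_mgf (Wfin x))).
apply: le_lt_trans; rewrite /mmt_gen_fun; apply: expectation_le => /=.
- exact: measurable_expRM.
- by apply: measurable_funM => //; exact: measurable_expRM.
- by move=> w; exact: expR_ge0.
- by move=> w; rewrite mulr_ge0 ?expR_ge0.
- exact: ae_expR_coupling.
Qed.

Lemma mgf_coupling_le d (T : measurableType d) (R : realType)
    (P : probability T R) (W V : {RV P >-> R}) (K x : R) :
  ('M_P W x < +oo)%E -> ('M_P V x < +oo)%E ->
  {ae P, forall w, `|V w - W w| <= K} ->
  \int[P]_w (expR (V w * x))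
    <= expR (K * `|x|) * \int[P]_w (expR (W w * x)).
Proof.
move=> /integrable_mgf Wx /integrable_mgf Vx VW.
rewrite -RintegralZl//; apply: ge0_ae_le_Rintegral => //.
- exact: (integrableZl measurableT _ Wx).
- exact: ae_expR_coupling.
Qed.

Lemma size_biased_mgf d (T : measurableType d) (R : realType)
    (P : probability T R) (W V : {RV P >-> R}) (mu x : R) :
  ('E_P[W] = mu%:E)%E -> size_biased W V ->
  (forall y : R, 'M_P W y < +oo)%E -> ('M_P V x < +oo)%E ->
  \int[P]_w (W w * expR (W w * x)) = mu * \int[P]_w (expR (V w * x)).
Proof.
move=> EW WV Wfin Vx.
have iWx := integrable_mul_mgf x Wfin; have iV := integrable_mgf Vx.
have mf : measurable_fun setT (fun y : R => expR (y * x)).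
  by apply: (measurableT_comp (@measurable_expR R)); exact: measurable_funM.
have := WV _ mf iWx iV; rewrite EW unlock => /(congr1 fine).
by rewrite fineM//; exact: integrable_fin_num.
Qed.

(** The factor [x] merges an upper bound for [x >= 0] and a lower bound for [x < 0]; the latter
    comes from the coupling with [W] and [V] exchanged. *)
Lemma size_biased_mgf_bound d (T : measurableType d) (R : realType)
    (P : probability T R) (W V : {RV P >-> R}) (mu K : R) :
  0 <= mu -> ('E_P[W] = mu%:E)%E -> size_biased W V ->
  (forall y : R, 'M_P W y < +oo)%E ->
  {ae P, forall w, `|V w - W w| <= K} ->
  forall x : R, x * \int[P]_w (W w * expR (W w * x))
    <= x * (mu * expR (K * x) * \int[P]_w (expR (W w * x))).
Proof.
move=> mu0 EW WV Wfin VW x.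
have Vfin := mgf_coupling_lty Wfin VW.
have WV' : {ae P, forall w, `|W w - V w| <= K}.
  by apply: filterS VW => w; rewrite distrC.
rewrite (size_biased_mgf EW WV Wfin (Vfin x)).
rewrite -mulrA !(mulrCA x mu) ler_wpM2l//.
case: (ger0P x) => x0.
  rewrite ler_wpM2l// (le_trans (mgf_coupling_le (Wfin x) (Vfin x) VW))//.
  by rewrite ger0_norm.
rewrite ler_nM2l//.
have := mgf_coupling_le (Vfin x) (Wfin x) WV'.
rewrite (ltr0_norm x0) mulrN expRN.
by rewrite ler_pdivlMl ?expR_gt0.
Qed.

Lemma size_biased_mgf_le d (T : measurableType d) (R : realType)
    (P : probability T R) (W V : {RV P >-> R}) (mu K : R) :
  0 <= mu -> 0 < K -> ('E_P[W] = mu%:E)%E -> size_biased W V ->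
  (forall y : R, 'M_P W y < +oo)%E ->
  {ae P, forall w, `|V w - W w| <= K} ->
  forall x : R, ('M_P W x <= (expR (mu / K * (expR (K * x) - 1)))%:E)%E.
Proof.
move=> mu0 K0 EW WV Wfin VW x.
pose m z := \int[P]_w (expR (W w * z)).
have MWE z : 'M_P W z = (m z)%:E.
  rewrite /mmt_gen_fun unlock /m /Rintegral fineK//.
  exact/integrable_fin_num/integrable_mgf.
have m0 : m 0 = 1.
  rewrite /m; under eq_Rintegral do rewrite mulr0 expR0.
  rewrite Rintegral_cst// mul1r.
  exact: (congr1 fine (probability_setT P)).
pose c z := mu * expR (K * z).
(* The tilt is taken at the endpoint [r * x], farther from 0. As [r * x - s * x] is a nonnegative
   multiple of [r * x], the sign condition of [mgf_tilt_le] is the previous bound, rescaled. *)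
have incr (s r : R) : 0 <= s -> s <= r ->
    m (r * x) <= expR ((r * x - s * x) * c (r * x)) * m (s * x).
  move=> s0 sr; apply: mgf_tilt_le => //.
  have [r0|r0] := eqVneq r 0.
    have s_eq0 : s = 0 by apply: le_anti; rewrite s0 -r0 sr.
    by rewrite s_eq0 r0 subrr !mul0r.
  have r_gt0 : 0 < r by rewrite lt_neqAle eq_sym r0 (le_trans s0).
  have -> : r * x - s * x = ((r - s) / r) * (r * x) by field.
  rewrite -!(mulrA ((r - s) / r)); apply: ler_wpM2l.
    by rewrite divr_ge0 ?subr_ge0// ltW.
  exact: (size_biased_mgf_bound mu0 EW WV Wfin VW).
(* Jensen at the untilted law, whose mean is [mu], gives [1 <= expR (- z * mu) * m z]. *)
have m_gt0 z : 0 < m z.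
  have : m 0 <= expR ((0 - z) * mu) * m z.
    apply: mgf_tilt_le => //; rewrite -/(m 0) m0 mulr1.
    under eq_Rintegral do rewrite mulr0 expR0 mulr1.
    by rewrite /Rintegral -(expectation_def W) EW.
  rewrite m0 => /(lt_le_trans ltr01).
  by rewrite pmulr_rgt0 ?expR_gt0.
rewrite MWE lee_fin -ler_ln ?posrE ?m_gt0 ?expR_gt0// expRK.
(* [G] is the primitive of [c] vanishing at 0. On a step from [s] to [r], [ln m] grows by at most
   [(r - s) * x * c (r * x)] and, by convexity, [G] by at least [(r - s) * x * c (s * x)]; the
   difference is the error governed by [k]. *)
pose G z := mu / K * (expR (K * z) - 1).
have := @le_of_increment_le R (fun s => ln (m (s * x)) - G (s * x))
  (fun s => x * c (s * x)).
rewrite !mul1r !mul0r m0 ln1 /G mulr0 expR0 subrr mulr0 subrr subr_le0.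
apply=> s r s0 sr r1.
have := incr s r s0 sr; rewrite -ler_ln ?posrE ?mulr_gt0 ?m_gt0 ?expR_gt0//.
rewrite lnM ?posrE ?m_gt0 ?expR_gt0// expRK.
have : (r * x - s * x) * c (s * x) <= G (r * x) - G (s * x).
  rewrite /G /c -mulrBr.
  have -> : (r * x - s * x) * (mu * expR (K * (s * x)))
    = mu / K * ((r * x - s * x) * expR (K * (s * x)) * K).
    by field; rewrite gt_eqF.
  rewrite ler_wpM2l ?divr_ge0 ?(ltW K0)//.
  have := mul_expRB1_le K (r * x) (s * x). lra.
rewrite -/(G (r * x)) -/(G (s * x)); lra.
Qed.

(** * Positivity of the mean, Chernoff exponents and the two tails *)

Lemma ae_ge0_expectation_ge0 d (T : measurableType d) (R : realType)
    (P : probability T R) (W : {RV P >-> R}) :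
  {ae P, forall w, 0 <= W w} -> (0 <= 'E_P[W])%E.
Proof.
move=> W0; rewrite unlock.
rewrite (@ae_eq_integral _ _ _ P setT (fun w => (Num.max (W w) 0)%:E))//.
- by apply: integral_ge0 => w _; rewrite lee_fin le_max lexx orbT.
- exact/measurable_EFinP.
- by apply/measurable_EFinP; exact: measurable_maxr.
- by apply: filterS W0 => w W0 _; rewrite max_l.
Qed.

(** For a tilt [- a], [expR_le_quad] bounds the exponent by [K * mu * a ^+ 2 - a * t], which is
    minimal at [a = t / (2 * K * mu)]. *)
Lemma lower_exponent_le (R : realType) (mu K t : R) :
  0 < mu -> 0 < K -> 0 <= t ->
  mu / K * (expR (K * - (t / (2 * K * mu))) - 1)
    - t / (2 * K * mu) * (t - mu) <= - (t ^+ 2 / (4 * K * mu)).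
Proof.
move=> mu0 K0 t0.
have -> : K * - (t / (2 * K * mu)) = - (t / (2 * mu)).
  by field; rewrite !gt_eqF.
have := @expR_le_quad R (- (t / (2 * mu))).
rewrite oppr_le0 divr_ge0 ?mulr_ge0 ?(ltW mu0)// => /(_ isT) h.
have {}h := ler_wpM2l (ltW (divr_gt0 mu0 K0)) h.
apply: (@le_trans _ _ (mu / K * (- (t / (2 * mu)) + (- (t / (2 * mu))) ^+ 2)
    - t / (2 * K * mu) * (t - mu))); first by lra.
by rewrite le_eqVlt; apply/orP; left; apply/eqP; field; rewrite !gt_eqF.
Qed.

Lemma upper_exponent_le (R : realType) (mu K t : R) :
  0 < mu -> 0 < K -> 0 <= t ->
  mu / K * (expR (K * (2 * t / (4 * K * mu + K * t))) - 1)
    - 2 * t / (4 * K * mu + K * t) * (mu + t)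
  <= - (t ^+ 2 / (4 * K * mu + K * t)).
Proof.
move=> mu0 K0 t0.
have D0 : 0 < 4 * mu + t by lra.
have -> : 4 * K * mu + K * t = K * (4 * mu + t) by ring.
pose v := t / (4 * mu + t).
have -> : 2 * t / (K * (4 * mu + t)) = 2 * v / K.
  by rewrite /v; field; rewrite !gt_eqF.
have -> : t ^+ 2 / (K * (4 * mu + t)) = t * v / K.
  by rewrite /v; field; rewrite !gt_eqF.
have -> : K * (2 * v / K) = 2 * v by field; rewrite gt_eqF.
have v0 : 0 <= v by rewrite divr_ge0// ltW.
have v1 : v < 1 by rewrite /v ltr_pdivrMr//; lra.
have tv : t * (1 - v) = 4 * mu * v by rewrite /v; field; rewrite gt_eqF.
have := @expR_le_pade R v; rewrite v0 v1 => /(_ isT) h.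
(* After multiplication by [1 - v = 4 * mu / (4 * mu + t)] the right-hand side becomes
   [4 * mu * v ^+ 2], and [(1 + 2 * v) * (1 - v) + 4 * v ^+ 2 = 1 + v + 2 * v ^+ 2] turns the claim
   into [expR_le_pade]. *)
suff : mu * (expR (2 * v) - 1 - 2 * v) <= t * v.
  rewrite -(ler_pM2r (_ : 0 < K^-1)) ?invr_gt0//; lra.
rewrite -(ler_pM2r (_ : 0 < 1 - v)) ?subr_gt0//.
have -> : t * v * (1 - v) = mu * (4 * v ^+ 2) by rewrite mulrAC tv; ring.
by rewrite -mulrA ler_pM2l//; lra.
Qed.

Lemma chernoff_le d (T : measurableType d) (R : realType)
    (P : probability T R) (X : {RV P >-> R}) (r a L : R) :
  0 < r -> ('M_P X r <= (expR L)%:E)%E ->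
  (P [set w | (X w >= a)%R] <= (expR (L - r * a))%:E)%E.
Proof.
move=> r0 XL; apply: (le_trans (chernoff X a r0)).
by rewrite expRD EFinM lee_wpmul2r// lee_fin expR_ge0.
Qed.

Local Open Scope ereal_scope.

Theorem corollary2p2 (d : measure_display) (T : measurableType d)
    (R : realType) (P : probability T R) (W : {RV P >-> R})
    (W_ge0 : {ae P, forall w, (0 <= W w)%R})
    (mu : R) (W_mean : 'E_P[W] = mu%:E) (mu_neq0 : mu != 0%R)
    (W_mgf : forall theta : R, 'M_P W theta < +oo)
    (K : R) (K_gt0 : (0 < K)%R)
    (W_coupling : exists Ws : {RV P >-> R},
       size_biased W Ws /\ {ae P, forall w, (`|Ws w - W w| <= K)%R})
    (t : R) (t_ge0 : (0 <= t)%R) :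
  P [set w | (W w - mu <= - t)%R]
    <= (expR (- (t ^+ 2 / (4 * K * mu))))%:E
  /\
  P [set w | (W w - mu >= t)%R]
    <= (expR (- (t ^+ 2 / (4 * K * mu + K * t))))%:E.
Proof.
have [V [WV VW]] := W_coupling.
have mu_gt0 : (0 < mu)%R.
  rewrite lt_neqAle eq_sym mu_neq0 -lee_fin -W_mean.
  exact: ae_ge0_expectation_ge0.
have M_le := size_biased_mgf_le (ltW mu_gt0) K_gt0 W_mean WV W_mgf VW.
(* At [t = 0] both tilts vanish, while Chernoff's bound needs a positive one; there both claims say
   that a probability is at most 1. *)
have [->|t_neq0] := eqVneq t 0%R.
  rewrite expr0n/= !mul0r oppr0 expR0.
  have mW : measurable_fun setT (fun w => (W w - mu)%R).
    exact: measurable_funB.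
  split; apply: probability_le1; rewrite -[X in measurable X]setTI.
  - exact: (measurable_fun_le measurableT mW (measurable_cst _)).
  - exact: (measurable_fun_le measurableT (measurable_cst _) mW).
have t_gt0 : (0 < t)%R by rewrite lt_neqAle eq_sym t_neq0.
split.
(* The lower tail of [W] is an upper tail of [- W], whose moment generating function at [r] is that
   of [W] at [- r]. *)
- pose N : {RV P >-> R} := (- W)%R.
  have NW w : N w = (- W w)%R by [].
  rewrite (_ : [set w | _] = [set w | (N w >= t - mu)%R]); last first.
    by apply/seteqP; split=> w; rewrite /mkset NW; lra.
  apply: (le_trans (@chernoff_le _ _ _ P N _ _ _
    (_ : (0 < t / (2 * K * mu))%R) _)).
  + by rewrite divr_gt0 ?mulr_gt0.
  + rewrite /mmt_gen_fun (_ : _ \o _ = expR \o (- (t / (2 * K * mu)))%R \o* W).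
      exact: M_le.
    apply/funext => w; congr expR.
    exact: etrans (mulNr _ _) (esym (mulrN _ _)).
  + by rewrite lee_fin ler_expR; exact: lower_exponent_le.
- rewrite (_ : [set w | _] = [set w | (W w >= mu + t)%R]); last first.
    by apply/seteqP; split=> w /=; lra.
  have D_gt0 : (0 < 4 * K * mu + K * t)%R by rewrite addr_gt0 ?mulr_gt0.
  apply: (le_trans (chernoff_le _
    (_ : (0 < 2 * t / (4 * K * mu + K * t))%R) (M_le _))).
  + by rewrite divr_gt0 ?mulr_gt0.
  + by rewrite lee_fin ler_expR; exact: upper_exponent_le.
Qed.
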